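(* Let $T>0$, $g\in L^2(\Omega)$, $\delta>0$, $K>0$ and $s\in(0,T)$ be given. Let $u_1,u_2$ be two solutions on $[0,T]$ of $$\frac{\partial u_j}{\partial t}+Au_j=0\quad\text{on }\Omega\times(0,T),\qquad j=1,2,$$ satisfying the constraints $$\|u_j(0)-g\|\le\delta\quad\text{and}\quad \|u_j(T)-u_j(s)\|\le K\delta,\qquad j=1,2.$$ Then $$\|u_1(t)-u_2(t)\|\le 2\Lambda^{t/T}\delta\qquad\text{for all }t\in[0,T],$$ where $\Lambda=\Lambda(K,s)$ is the unique (positive) root of the equation $x=K+x^{s/T}$.
   Context: $\Omega$ is a domain and $\|\cdot\|$ is the $L^2(\Omega)$-norm, with inner product $(\cdot,\cdot)$. $-A$ is a second-order linear uniformly elliptic partial differential operator on $\Omega$ with the homogeneous Dirichlet boundary condition on $\partial\Omega$, self-adjoint in $L^2(\Omega)$, having eigenvalues $0<\lambda_1\le\lambda_2\le\cdots<\infty$ (discrete spectrum, $\lambda_n\to\infty$) with corresponding orthonormal eigenfunctions $\phi_1,\phi_2,\dots$ forming an orthonormal basis of $L^2(\Omega)$; so $-A\phi_n=\lambda_n\phi_n$ (for example $A=\Delta$, and the equation is the backward heat equation). A solution $u$ of $\partial u/\partial t+Au=0$ on $[0,T]$ is an $L^2(\Omega)$-valued function given by $u(t)=\sum_{n\ge1}(u(0),\phi_n)e^{\lambda_n t}\phi_n$, the series converging in $L^2(\Omega)$ for every $t\in[0,T]$. *)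

(* Defs.v *)
From HB Require Import structures.
From mathcomp Require Import all_boot all_order all_algebra.
From mathcomp Require Import all_classical all_reals all_analysis.

Set Implicit Arguments.
Unset Strict Implicit.
Unset Printing Implicit Defensive.
Import Order.TTheory GRing.Theory Num.Theory.
Import numFieldNormedType.Exports.
Local Open Scope classical_set_scope.
Local Open Scope ring_scope.

Fact borel_rV_display : measure_display. Proof. exact: default_measure_display. Qed.

Section borel_rV.
Context (R : realType) (n : nat).
Let borel : set (set 'rV[R]_n) := <<s [set U : set 'rV[R]_n | open U] >>.

Let borel0 : borel set0. Proof. exact: sigma_algebra0. Qed.
Let borelC A : borel A -> borel (~` A). Proof. exact: sigma_algebraC. Qed.
Let borel_bigcup (F : (set 'rV[R]_n)^nat) :
  (forall i, borel (F i)) -> borel (\bigcup_i F i).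
Proof. exact: sigma_algebra_bigcup. Qed.

HB.instance Definition _ := @isMeasurable.Build borel_rV_display
  'rV[R]_n borel borel0 borelC borel_bigcup.

Lemma open_rV_measurable (U : set 'rV[R]_n) : open U -> measurable U.
Proof. by move=> oU; apply: sub_sigma_algebra. Qed.

Definition rational_cube (qk : 'rV[rat]_n * nat) : set 'rV[R]_n :=
  ball (map_mx ratr qk.1 : 'rV[R]_n) qk.2.+1%:R^-1.

Lemma open_rV_bigcup_cube (U : set 'rV[R]_n) : open U ->
  U = \bigcup_(qk in [set qk | rational_cube qk `<=` U]) rational_cube qk.
Proof.
move=> oU; apply/seteqP; split => [x Ux|x [qk] /= + ?]; last exact.
have /nbhs_ballP[e /= e0 xeU] : nbhs x U by exact: open_nbhs_nbhs.
have [k ke] : exists k : nat, k.+1%:R^-1 < e / 2.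
  exists (Num.truncn (e / 2)^-1).
  rewrite invf_plt ?posrE ?divr_gt0//.
  by have := truncnS_gt (e / 2)^-1.
have k0 : (0 : R) < k.+1%:R^-1 by rewrite invr_gt0.
have /choice[q qx] : forall j : 'I_n, exists q : rat,
    ball (x ord0 j) k.+1%:R^-1 (ratr q).
  move=> j; have /rat_in_itvoo[q] : x ord0 j < x ord0 j + k.+1%:R^-1.
    by rewrite ltrDl.
  rewrite in_itv/= => /andP[xq qx]; exists q.
  by rewrite /ball/= ltr_distlC (lt_le_trans _ (ltW xq)) ?gtrBl.
have xq : ball (map_mx ratr (\row_j q j) : 'rV[R]_n) k.+1%:R^-1 x.
  by split => // i j; rewrite !mxE ord1; exact: ball_sym.
exists (\row_j q j, k) => //= y qy; apply: xeU.
apply: (@le_ball _ _ _ (k.+1%:R^-1 + k.+1%:R^-1)).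
  by rewrite (le_trans (lerD (ltW ke) (ltW ke)))// -splitr.
by apply: ball_triangle qy; exact: ball_sym.
Qed.

Lemma measurable_coord_rV (j : 'I_n) :
  measurable_fun [set: 'rV[R]_n] (fun x : 'rV[R]_n => x ord0 j).
Proof.
apply: (measurability _ (measurable_realfun.RGenOInfty.measurableE R)).
move=> _ [_ [a ->] <-]; rewrite setTI; apply: open_rV_measurable.
apply: open_comp => [x _|]; first exact: coord_continuous.
exact: interval_open.
Qed.

Lemma measurable_rV_box (B : 'I_n -> set R) : (forall i, measurable (B i)) ->
  measurable [set x : 'rV[R]_n | forall i, B i (x ord0 i)].
Proof.
move=> mB; rewrite -[X in measurable X]setCK; apply: measurableC.
rewrite [X in measurable X](_ : _ =
  \bigcup_i ~` ((fun x : 'rV[R]_n => x ord0 i) @^-1` B i)).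
  apply: countable_bigcupT_measurable => // i; apply: measurableC.
  by rewrite -[X in measurable X]setTI; exact: measurable_coord_rV.
by apply/seteqP; split => [x /existsNP[i Bi]|x [i _ Bi] /(_ i)//]; exists i.
Qed.

End borel_rV.

Section lebesgue_rV.
Context (R : realType).

Definition row_cons n (p : R * 'rV[R]_n) : 'rV[R]_n.+1 :=
  row_mx (p.1%:M : 'rV_1) p.2.

Lemma measurable_row_cons n : measurable_fun [set: R * 'rV[R]_n] (@row_cons n).
Proof.
apply: (@measurability _ _ _ _ _ _ [set U : set 'rV[R]_n.+1 | open U]) => //.
move=> _ [U oU <-]; rewrite setTI (open_rV_bigcup_cube oU).
rewrite preimage_bigcup bigcup_mkcond.
apply: countable_bigcupT_measurable => // -[q k]; case: ifPn => // _.
set e : R := k.+1%:R^-1; have e0 : 0 < e by rewrite invr_gt0.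
rewrite [X in measurable X](_ : _ =
    ball (ratr (q ord0 (lshift n (ord0 : 'I_1))) : R) e `*`
    ball (map_mx ratr (rsubmx (q : 'rV_(1 + n))) : 'rV[R]_n) e).
  apply: measurableX; first by apply: measurable_realfun.open_measurable; exact: ball_open.
  by apply: open_rV_measurable; exact: ball_open.
apply/seteqP; split => [[x v] [_ /= H]|[x v] [/= xq [_ vq]]].
  split => /=; [have := H ord0 (lshift n (ord0 : 'I_1))|split => // i j;
    have := H ord0 (rshift 1 j)].
    by rewrite /row_cons /= mxE (row_mxEl _ _ _ (ord0 : 'I_1)) mxE eqxx.
  by rewrite /row_cons /= (ord1 i) (row_mxEr (x%:M : 'rV_1)) !mxE.
split => // i j; rewrite (ord1 i) mxE.
rewrite -[j]/(j : 'I_(1 + n)); case: (@split_ordP 1 n j) => l ->.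
  by rewrite /row_cons /= (row_mxEl (x%:M : 'rV_1)) mxE !ord1.
by rewrite /row_cons /= (row_mxEr (x%:M : 'rV_1)); have := vq ord0 l; rewrite !mxE.
Qed.

Definition lebesgue_cons n (mu : {measure set 'rV[R]_n -> \bar R}) :=
  pushforward (@lebesgue_measure R \x^ mu)%E (@row_cons n).

Section lebesgue_cons_measure.
Context n (mu : {measure set 'rV[R]_n -> \bar R}).
Let mcons := @measurable_row_cons n.

Let lebesgue_cons0 : lebesgue_cons mu set0 = 0%E.
Proof. exact: measure0. Qed.

Let lebesgue_cons_ge0 A : (0 <= lebesgue_cons mu A)%E.
Proof. exact: measure_ge0. Qed.

Let lebesgue_cons_sigma_additive : semi_sigma_additive (lebesgue_cons mu).
Proof. exact: measure_semi_sigma_additive. Qed.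

HB.instance Definition _ := isMeasure.Build _ _ _ (lebesgue_cons mu)
  lebesgue_cons0 lebesgue_cons_ge0 lebesgue_cons_sigma_additive.

End lebesgue_cons_measure.

Fixpoint lebesgue_rV n : {measure set 'rV[R]_n -> \bar R} :=
  match n with
  | 0 => dirac (0 : 'rV[R]_0)
  | n.+1 => lebesgue_cons (lebesgue_rV n)
  end.

Lemma lebesgue_rV_box n (B : 'I_n -> set R) : (forall i, measurable (B i)) ->
  lebesgue_rV n [set x | forall i, B i (x ord0 i)] =
  (\prod_(i < n) @lebesgue_measure R (B i))%E.
Proof.
elim: n B => [|n IH] B mB.
  by rewrite big_ord0 /= diracE mem_set// => -[].
rewrite big_ord_recl -(IH (fun i => B (lift ord0 i)))//.
rewrite -product_measure2E; last 2 first.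
- exact: mB.
- by apply: (@measurable_rV_box _ _ (fun i => B (lift ord0 i))) => i.
rewrite /= /lebesgue_cons /pushforward; congr (_ _).
have cons0 (x : R) (v : 'rV[R]_n) : row_cons (x, v) ord0 ord0 = x.
  have -> : ord0 = lshift n (ord0 : 'I_1) :> 'I_n.+1 by exact: val_inj.
  by rewrite /row_cons /= (row_mxEl (x%:M : 'rV_1)) mxE eqxx.
have consS (x : R) (v : 'rV[R]_n) i :
    row_cons (x, v) ord0 (lift ord0 i) = v ord0 i.
  have -> : lift ord0 i = rshift 1 i :> 'I_n.+1 by exact: val_inj.
  by rewrite /row_cons /= (row_mxEr (x%:M : 'rV_1)).
apply/seteqP; split => [[x v] /= H|[x v] [/= Bx Bv] i].
  split => /= [|i]; first by have := H ord0; rewrite cons0.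
  by have := H (lift ord0 i); rewrite consS.
by case: (unliftP ord0 i) => [j|] ->; rewrite ?consS ?cons0.
Qed.

End lebesgue_rV.

Section L2.
Context (R : realType) (n : nat) (Omega : set 'rV[R]_n) (oOmega : open Omega).

Definition lebesgue_on : {measure set 'rV[R]_n -> \bar R} :=
  mrestr (lebesgue_rV R n) (open_rV_measurable oOmega).

(* Elements are square-integrable functions rather than classes modulo
   equality a.e.: two of them are the same vector of L^2(Omega) when the L2norm
   of their difference is 0, and all the definitions below respect this. Only
   the values on Omega matter, because lebesgue_on vanishes outside Omega. *)
Definition L2 := LfunType lebesgue_on (lee1n 2).

Definition L2norm (f : L2) : R := fine ('N[lebesgue_on]_2%:E[EFin \o f])%E.

Definition L2inner (f g : L2) : R := \int[lebesgue_on]_x (f x * g x).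

Definition orthonormal_basis (phi : nat -> L2) :=
  (forall i j, L2inner (phi i) (phi j) = (i == j)%:R) /\
  forall f : L2,
    L2norm (\sum_(k < N) L2inner f (phi k) *: phi k - f) @[N --> \oo] --> 0.

(* An unbounded operator on L^2(Omega) is given by its graph G. *)
Definition self_adjoint (G : L2 -> L2 -> Prop) :=
  (forall h e, 0 < e -> exists u f, G u f /\ L2norm (u - h) < e) /\
  forall v w, G v w <-> forall u f, G u f -> L2inner f v = L2inner u w.

End L2.

Section elliptic.
Context (R : realType) (n : nat).
Implicit Types (v : 'rV[R]_n -> R).

Definition partial (i : 'I_n) v : 'rV[R]_n -> R :=
  fun x => 'D_(delta_mx ord0 i) v x.

Definition smooth v :=
  forall (s : seq 'I_n) (x : 'rV[R]_n), differentiable (foldr partial v s) x.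

(* v belongs to C_c^oo(Omega) *)
Definition test_function (Omega : set 'rV[R]_n) v :=
  smooth v /\
  exists K : set 'rV[R]_n,
    [/\ compact K, K `<=` Omega & forall x, ~ K x -> v x = 0].

(* Coefficients of the operator
   u |-> - \sum_(i, j) d_i (a_ij d_j u) + \sum_i b_i d_i u + c u. *)
Record second_order_operator := SecondOrderOperator {
  coef_a : 'I_n -> 'I_n -> 'rV[R]_n -> R;
  coef_b : 'I_n -> 'rV[R]_n -> R;
  coef_c : 'rV[R]_n -> R
}.

Context (Omega : set 'rV[R]_n) (oOmega : open Omega).
Local Notation mu := (lebesgue_on oOmega).
Local Notation L2 := (L2 oOmega).

(* Membership in L^oo_loc(Omega). *)
Definition locally_bounded (f : 'rV[R]_n -> R) :=
  measurable_fun Omega f /\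
  forall K : set 'rV[R]_n, compact K -> K `<=` Omega ->
    exists M : R, {ae mu, forall x, K x -> `|f x| <= M}.

Definition uniformly_elliptic (L : second_order_operator) :=
  [/\ forall i j, locally_bounded (coef_a L i j),
      forall i, locally_bounded (coef_b L i),
      locally_bounded (coef_c L) &
      exists2 theta : R, 0 < theta &
        {ae mu, forall x, forall xi : 'rV[R]_n,
          theta * \sum_i xi ord0 i ^+ 2 <=
          \sum_i \sum_j coef_a L i j x * xi ord0 i * xi ord0 j}].

(* u is in H^1_0(Omega), the closure of C_c^oo(Omega) in H^1(Omega), and its
   weak gradient is g. *)
Definition H10_gradient (u : L2) (g : 'I_n -> L2) :=
  exists v : nat -> 'rV[R]_n -> R,
    [/\ forall k, test_function Omega (v k),
        ('N[mu]_2%:E[EFin \o (v k \- u)%R])%E @[k --> \oo] --> 0%E &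
        forall i, ('N[mu]_2%:E[EFin \o (partial i (v k) \- g i)%R])%E
          @[k --> \oo] --> 0%E].

(* Graph of the realization of L in L^2(Omega) with the homogeneous Dirichlet
   boundary condition: u is in H^1_0(Omega) and L u = f weakly. *)
Definition dirichlet (L : second_order_operator) (u f : L2) :=
  exists2 g : 'I_n -> L2, H10_gradient u g &
    forall v, test_function Omega v ->
      \int[mu]_x ((\sum_i \sum_j coef_a L i j x * g j x * partial i v x)
                  + (\sum_i coef_b L i x * g i x) * v x
                  + coef_c L x * u x * v x)
      = \int[mu]_x (f x * v x).

(* Solutions on [0, T] of the equation du/dt + A u = 0, where - A has the
   eigenvalues lambda and the orthonormal basis of eigenfunctions phi. *)
Definition is_solution (lambda : nat -> R) (phi : nat -> L2) (T : R)
    (u : R -> L2) :=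
  forall t : R, 0 <= t <= T ->
    L2norm (\sum_(k < N) (L2inner (u 0) (phi k) * expR (lambda k * t)) *: phi k
            - u t) @[N --> \oo] --> 0.

End elliptic.

(* Main.v *)
(* Let [n t] be the norm of [u1 t - u2 t], whose square is the sum of the
   [c k ^+ 2 * expR (2 * lambda k * t)]. By convexity of the exponential,
   [n t ^+ 2 <= Lambda `^ (2 * t / T) * ((1 - t / T) * n 0 ^+ 2
                                         + t / T * (n T / Lambda) ^+ 2)],
   a linear form of logarithmic convexity. As [n 0 <= 2 * delta] and
   [n T <= n s + 2 * K * delta], this bound at [t = s] together with
   [Lambda = K + Lambda `^ (s / T)] forces [n T <= 2 * Lambda * delta], and the
   same bound at an arbitrary [t] concludes. *)
Require Import Defs.
From mathcomp Require Import all_boot all_order all_algebra.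
From mathcomp Require Import all_classical all_reals all_analysis.
From mathcomp Require Import ring lra.

Set Implicit Arguments.
Unset Strict Implicit.

Import Order.TTheory GRing.Theory Num.Theory.
Import numFieldNormedType.Exports.
Local Open Scope classical_set_scope.
Local Open Scope ring_scope.

(** * Roots of the equation [x = K + x ^ a] *)

(** Since [z - z ^ a = z ^ a * (z ^ (1 - a) - 1)], beyond 1 this is a product of two nonnegative,
    strictly increasing factors. *)
Lemma subr_powR_lt (R : realType) (a x y : R) : 0 < a < 1 -> 1 < x -> x < y ->
  x - x `^ a < y - y `^ a.
Proof.
move=> /andP[a0 a1] x1 xy; have y1 := lt_trans x1 xy.
have x0 := lt_trans ltr01 x1; have y0 := lt_trans ltr01 y1.
have fact z : 0 < z -> z - z `^ a = z `^ a * (z `^ (1 - a) - 1).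
  move=> z0; rewrite mulrBr mulr1 -powRD ?subrKC ?powRr1 ?(ltW z0)//.
  by rewrite (gt_eqF z0) implybT.
rewrite !fact// ltr_pM ?powR_ge0//.
- by rewrite subr_ge0 -[leLHS](powRr0 x) ler_powR ?(ltW x1)// subr_ge0 ltW.
- by apply: gt0_ltr_powR => //; rewrite nnegrE ltW.
- by rewrite ltrD2r gt0_ltr_powR ?subr_gt0// nnegrE ltW.
Qed.

(** For [0 < x <= 1] one has [x <= x ^ a], which [K > 0] excludes. Thus every positive root lies
    where [x - x ^ a] is known to increase. *)
Lemma powR_fixpoint_gt1 (R : realType) (a K x : R) : a < 1 -> 0 < K -> 0 < x ->
  x = K + x `^ a -> 1 < x.
Proof.
move=> a1 K0 x0 xE; rewrite ltNge; apply/negP => x1.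
have : x <= x `^ a.
  by rewrite -{1}(powRr1 (ltW x0)) ger_powR ?x0// ltW.
by rewrite {1}xE; lra.
Qed.

Lemma powR_fixpoint_unique (R : realType) (a K x y : R) : 0 < a < 1 -> 0 < K ->
  0 < x -> x = K + x `^ a -> 0 < y -> y = K + y `^ a -> x = y.
Proof.
move=> a01 K0 x0 xE y0 yE; have /andP[_ a1] := a01.
have x1 := powR_fixpoint_gt1 a1 K0 x0 xE.
have y1 := powR_fixpoint_gt1 a1 K0 y0 yE.
have [xy|yx|//] := ltgtP x y.
  by have := subr_powR_lt a01 x1 xy; rewrite {1}xE {1}yE !addrK ltxx.
by have := subr_powR_lt a01 y1 yx; rewrite {1}xE {1}yE !addrK ltxx.
Qed.

(** Intermediate value theorem for [x - x ^ a] on [[1, M]]: the value is 0 at 1 and at least [K] at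
    [M]. *)
Lemma powR_fixpoint_exists (R : realType) (a K : R) : 0 < a < 1 -> 0 < K ->
  exists2 x : R, 0 < x & x = K + x `^ a.
Proof.
move=> /andP[a0 a1] K0; pose M := (1 + K) `^ (1 - a)^-1.
have K1 : 1 <= 1 + K by rewrite lerDl ltW.
have b0 : 0 < 1 - a by rewrite subr_gt0.
have M1 : 1 <= M by rewrite -[leLHS](powRr0 (1 + K)) ler_powR// invr_ge0 ltW.
have M0 := lt_le_trans ltr01 M1.
(* M is chosen so that M ^ (1 - a) = 1 + K, whence M - M ^ a = M ^ a * K >= K. *)
have MK : K <= M - M `^ a.
  have {1}-> : M = M `^ a * (1 + K).
    rewrite -[X in _ * X](powRr1 (le_trans ler01 K1)).
    rewrite -[X in (1 + K) `^ X](mulVf (lt0r_neq0 b0)) powRrM -/M.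
    by rewrite -powRD ?subrKC ?powRr1 ?(ltW M0)// (gt_eqF M0) implybT.
  rewrite mulrDr mulr1 addrAC subrr add0r.
  by rewrite ler_peMl ?(ltW K0)// -[leLHS](powRr0 M) ler_powR// ltW.
have [||x /[!in_itv]/= /andP[x1 _] xK] := @IVT R (fun x => x - x `^ a) 1 M K M1.
- apply: derivable_within_continuous => x /[!in_itv]/= /andP[x1 _].
  apply: derivableB => //; apply: derivable_powR.
  by rewrite in_itv/= andbT (lt_le_trans ltr01).
- by rewrite powR1 subrr ge_min ltW//= le_max MK orbT.
by exists x; [exact: lt_le_trans ltr01 x1|rewrite -xK subrK].
Qed.

(** * Scalar inequalities behind the interpolation *)

(* The chord of the convex function [exp] over [0, 2 (l T - ln m)], rescaled
   by [m ^ (2 t / T)]. *)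
Lemma expR_le_chord (R : realType) (l t T m : R) : 0 < T -> 0 <= t <= T ->
  0 < m ->
  expR (l * t) ^+ 2 <=
  (m `^ (t / T)) ^+ 2 * ((1 - t / T) + t / T * (expR (l * T) / m) ^+ 2).
Proof.
move=> T0 /andP[t0 tT] m0; have th0 : 0 <= t / T by rewrite divr_ge0// ltW.
have th1 : t / T <= 1 by rewrite ler_pdivrMr// mul1r.
have sq (z : R) : expR z ^+ 2 = expR (2 * z) by rewrite -expRM_natl.
have := @convex_expR R (Itv01 th0 th1) (2 * (l * T - ln m)) 0.
rewrite !convRE/= expR0 mulr0 addr0 mulr1 => H.
have -> : m `^ (t / T) = expR (t / T * ln m) by rewrite /powR gt_eqF.
have -> : expR (l * T) / m = expR (l * T - ln m).
  by rewrite expRD expRN lnK// posrE.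
rewrite !sq; apply: le_trans (_ : expR (2 * (t / T * ln m)) *
                     expR (t / T * (2 * (l * T - ln m))) <= _).
  by rewrite -expRD ler_expR le_eqVlt; apply/orP; left; apply/eqP; field; lra.
by rewrite ler_pM2l ?expR_gt0// [leRHS]addrC.
Qed.

(* If [b] exceeded [Lam * D], the interpolation bound would give
   [ns <= Lam ^ a / Lam * b] and then [b < (K + Lam ^ a) / Lam * b = b]. *)
Lemma le_of_interpolation (R : realType) (a K Lam D n0 ns b : R) :
  0 < a < 1 -> 0 < K -> 0 < Lam -> Lam = K + Lam `^ a -> 0 < D -> 0 <= n0 <= D -> 0 <= ns ->
  b <= ns + K * D ->
  ns ^+ 2 <= (Lam `^ a) ^+ 2 * ((1 - a) * n0 ^+ 2 + a * (b / Lam) ^+ 2) ->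
  b <= Lam * D.
Proof.
move=> /andP[a0 a1] K0 L0 LE D0 /andP[n00 n0D] ns0 bns nsE.
rewrite leNgt; apply/negP => Db.
have b0 : 0 < b by apply: lt_trans Db; exact: mulr_gt0.
pose y := b / Lam; have yD : D < y by rewrite ltr_pdivlMr// mulrC.
have y0 := lt_trans D0 yD.
have nsy : ns <= Lam `^ a * y.
  rewrite -(@ler_pXn2r _ 2)// ?nnegrE ?(mulr_ge0 (powR_ge0 _ _) (ltW y0))//.
  apply: (le_trans nsE); rewrite [leRHS]exprMn ler_wpM2l ?exprn_ge0 ?powR_ge0//.
  (* As [n0 <= D < y], the convex combination of [n0 ^ 2] and [y ^ 2] is at most [y ^ 2]. *)
  have : n0 ^+ 2 <= y ^+ 2 by rewrite ler_pXn2r ?nnegrE ?(ltW y0)//; lra.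
  rewrite -/y; nra.
have bE : b = Lam * y by rewrite mulrC divfK ?gt_eqF.
have : K * D < K * y by rewrite ltr_pM2l.
have : Lam * y = K * y + Lam `^ a * y by rewrite {1}LE mulrDl.
lra.
Qed.

(** * Norm and inner product of L^2(Omega) *)

Section L2_space.
Context (R : realType) (n : nat) (Omega : set 'rV[R]_n) (oOmega : open Omega).
Local Notation mu := (lebesgue_on oOmega).
Implicit Types f g h : L2 oOmega.

Lemma L2norm_ge0 f : 0 <= L2norm f.
Proof. by rewrite /L2norm fine_ge0// Lnorm_ge0. Qed.

Lemma L2normD f g : L2norm (f + g) <= L2norm f + L2norm g.
Proof. exact: ler_LnormD. Qed.

Lemma L2normN f : L2norm (- f) = L2norm f.
Proof. exact: LnormrN. Qed.

Lemma L2normB f g : L2norm (f - g) <= L2norm f + L2norm g.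
Proof. by rewrite -(L2normN g) L2normD. Qed.

(** Makes the norm continuous, so that convergence of the series of a solution passes to norms. *)
Lemma L2norm_dist_triangle f g : `|L2norm f - L2norm g| <= L2norm (f - g).
Proof.
rewrite ler_norml; apply/andP; split.
  have := L2normD f (g - f); rewrite subrKC -(L2normN (g - f)) opprB; lra.
by have := L2normD g (f - g); rewrite subrKC; lra.
Qed.

Lemma integrable_L2M f g : mu.-integrable setT (EFin \o (fun x => f x * g x)).
Proof. by apply/Lfun1_integrable; apply: Lfun2_mul_Lfun1; exact: LfunP. Qed.

Lemma L2innerC f g : L2inner f g = L2inner g f.
Proof. by apply: eq_Rintegral => x _; rewrite mulrC. Qed.

Lemma L2innerDl f g h : L2inner (f + g) h = L2inner f h + L2inner g h.
Proof.
rewrite /L2inner -RintegralD//; [|exact: integrable_L2M|exact: integrable_L2M].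
by apply: eq_Rintegral => x _; rewrite -mulrDl.
Qed.

Lemma L2innerZl (a : R) f g : L2inner (a *: f) g = a * L2inner f g.
Proof.
rewrite /L2inner -RintegralZl//; last exact: integrable_L2M.
by apply: eq_Rintegral => x _; rewrite mulrA.
Qed.

Lemma L2inner0l f : L2inner 0 f = 0.
Proof. by rewrite -(scale0r f) L2innerZl mul0r. Qed.

Lemma L2inner_suml N (c : nat -> R) (phi : nat -> L2 oOmega) g :
  L2inner (\sum_(k < N) c k *: phi k) g = \sum_(k < N) c k * L2inner (phi k) g.
Proof.
elim: N => [|N IHN]; first by rewrite !big_ord0 L2inner0l.
by rewrite !big_ord_recr/= L2innerDl IHN L2innerZl.
Qed.

Lemma sqr_L2norm f : L2norm f ^+ 2 = L2inner f f.
Proof.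
rewrite -powR_mulrn ?L2norm_ge0//.
have two0 : (2 : R) != 0 by rewrite pnatr_eq0.
have := powR_Lnorm mu (EFin \o f) two0.
(* The norm of an element of [L2] is finite, so the extended-real identity transfers to [R] through
   [fine]. *)
rewrite -finite_norm_fine poweR_EFin -/(L2norm f) => /(congr1 fine)/= ->.
congr fine; apply: eq_integral => x _ /=.
by rewrite powR_mulrn// real_normK ?num_real// expr2.
Qed.

(** Pythagoras: by orthonormality only the diagonal terms survive. *)
Lemma sqr_L2norm_sum N (c : nat -> R) (phi : nat -> L2 oOmega) :
  (forall i j, L2inner (phi i) (phi j) = (i == j)%:R) ->
  L2norm (\sum_(k < N) c k *: phi k) ^+ 2 = \sum_(k < N) c k ^+ 2.
Proof.
move=> on; rewrite sqr_L2norm L2inner_suml; apply: eq_bigr => i _.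
rewrite L2innerC L2inner_suml (bigD1 i)//= on eqxx mulr1 big1 ?addr0 ?expr2//.
move=> j ji; rewrite on (_ : (val j == val i) = false) ?mulr0//.
exact: negbTE.
Qed.

End L2_space.

(** * Interpolation for the difference of two solutions *)

(** Parseval at time [t]: the sums are the squared norms of the partial sums of the series of
    [u1 t - u2 t], which converge in norm. *)
Lemma cvg_sqr_L2norm_diff (R : realType) (n : nat) (Omega : set 'rV[R]_n)
    (oOmega : open Omega) (phi : nat -> L2 oOmega) (lambda : nat -> R)
    (T : R) (u1 u2 : R -> L2 oOmega) (t : R) :
  (forall i j, L2inner (phi i) (phi j) = (i == j)%:R) ->
  is_solution lambda phi T u1 -> is_solution lambda phi T u2 -> 0 <= t <= T ->
  \sum_(k < N) (L2inner (u1 0) (phi k) - L2inner (u2 0) (phi k)) ^+ 2 *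
    expR (lambda k * t) ^+ 2 @[N --> \oo] --> L2norm (u1 t - u2 t) ^+ 2.
Proof.
move=> on sol1 sol2 tT.
pose c1 k := L2inner (u1 0) (phi k) * expR (lambda k * t).
pose c2 k := L2inner (u2 0) (phi k) * expR (lambda k * t).
rewrite (_ : (fun N => _) = fun N : nat =>
    L2norm (\sum_(k < N) (c1 k - c2 k) *: phi k) ^+ 2); last first.
  apply/funext => N; rewrite (sqr_L2norm_sum N (fun k => c1 k - c2 k))//.
  by apply: eq_bigr => k _; rewrite -exprMn mulrBl.
suff h : L2norm (\sum_(k < N) (c1 k - c2 k) *: phi k) @[N --> \oo] -->
    L2norm (u1 t - u2 t) by apply: cvgM.
apply: (@cvg_zero _ R^o) => /=; apply: norm_cvg0.
(* The sum of the two truncation errors dominates the difference of the norms. *)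
have h0 : L2norm (\sum_(k < N) c1 k *: phi k - u1 t)
    + L2norm (\sum_(k < N) c2 k *: phi k - u2 t) @[N --> \oo] --> (0 : R).
  by rewrite -[X in _ --> X]addr0; apply: cvgD; [exact: sol1|exact: sol2].
apply: squeeze_cvgr (cvg_cst 0) h0; apply: nearW => N /=.
rewrite normr_ge0/=; apply: le_trans (L2norm_dist_triangle _ _) _.
apply: le_trans (L2normB _ _); rewrite le_eqVlt; apply/orP; left.
apply/eqP; congr L2norm.
rewrite (eq_bigr _ (fun k _ => scalerBl _ _ _)) big_split sumrN.
by rewrite !opprD !opprK addrACA.
Qed.

(** The chord inequality [expR_le_chord] holds for each mode; it is weighted by [d k >= 0], summed
    and passed to the limit. *)
Lemma L2norm_diff_interpolation (R : realType) (n : nat) (Omega : set 'rV[R]_n)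
    (oOmega : open Omega) (phi : nat -> L2 oOmega) (lambda : nat -> R)
    (T : R) (u1 u2 : R -> L2 oOmega) (m t : R) :
  (forall i j, L2inner (phi i) (phi j) = (i == j)%:R) ->
  is_solution lambda phi T u1 -> is_solution lambda phi T u2 ->
  0 < T -> 0 <= t <= T -> 0 < m ->
  L2norm (u1 t - u2 t) ^+ 2 <=
  (m `^ (t / T)) ^+ 2 * ((1 - t / T) * L2norm (u1 0 - u2 0) ^+ 2
                         + t / T * (L2norm (u1 T - u2 T) / m) ^+ 2).
Proof.
move=> on sol1 sol2 T0 tT m0.
pose d k := (L2inner (u1 0) (phi k) - L2inner (u2 0) (phi k)) ^+ 2.
pose S r N := \sum_(k < N) d k * expR (lambda k * r) ^+ 2.
have cvgS r : 0 <= r <= T -> S r N @[N --> \oo] --> L2norm (u1 r - u2 r) ^+ 2.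
  by move=> rT; exact: (cvg_sqr_L2norm_diff on sol1 sol2 rT).
have cvgR : (m `^ (t / T)) ^+ 2 * ((1 - t / T) * S 0 N
      + t / T * (S T N * m^-1 ^+ 2)) @[N --> \oo] -->
    (m `^ (t / T)) ^+ 2 * ((1 - t / T) * L2norm (u1 0 - u2 0) ^+ 2
      + t / T * (L2norm (u1 T - u2 T) ^+ 2 * m^-1 ^+ 2)).
  apply: cvgMl_tmp; apply: cvgD; apply: cvgMl_tmp.
    by apply: cvgS; rewrite lexx ltW.
  by apply: cvgMr_tmp; apply: cvgS; rewrite lexx ltW.
rewrite exprMn; apply: ler_cvg_to (cvgS t tT) cvgR _; apply: nearW => N.
rewrite /S mulr_suml !mulr_sumr -big_split/= mulr_sumr; apply: ler_sum => k _.
rewrite mulr0 expR0 expr1n mulr1.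
have := expR_le_chord (lambda k) T0 tT m0; rewrite exprMn.
have d0 : 0 <= d k by exact: sqr_ge0.
move=> /(ler_wpM2l d0) /le_trans; apply.
by rewrite le_eqVlt; apply/orP; left; apply/eqP; ring.
Qed.

Unset Implicit Arguments.
Set Strict Implicit.

(* minusA is the operator - A, and lambda n, phi n are the eigenvalue and the
   eigenfunction numbered n.+1 in the usual enumeration starting from 1. *)
Theorem theorem3p1 (R : realType) (d : nat) (Omega : set 'rV[R]_d.+1)
    (oOmega : open Omega) (cOmega : connected Omega) (Omega_neq0 : Omega !=set0)
    (minusA : second_order_operator R d.+1)
    (ellA : uniformly_elliptic oOmega minusA)
    (saA : self_adjoint (dirichlet (oOmega := oOmega) minusA))
    (lambda : nat -> R) (phi : nat -> L2 oOmega)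
    (lambda_gt0 : 0 < lambda 0%N)
    (lambda_nd : {homo lambda : m n / (m <= n)%N >-> m <= n})
    (lambda_oo : lambda n @[n --> \oo] --> +oo)
    (phi_basis : orthonormal_basis phi)
    (phi_eigen : forall n, dirichlet minusA (phi n) (lambda n *: phi n))
    (T : R) (T_gt0 : 0 < T) (g : L2 oOmega)
    (delta : R) (delta_gt0 : 0 < delta) (K : R) (K_gt0 : 0 < K)
    (s : R) (s_itv : 0 < s < T)
    (u1 u2 : R -> L2 oOmega)
    (sol1 : is_solution lambda phi T u1) (sol2 : is_solution lambda phi T u2)
    (init1 : L2norm (u1 0 - g) <= delta) (init2 : L2norm (u2 0 - g) <= delta)
    (fin1 : L2norm (u1 T - u1 s) <= K * delta)
    (fin2 : L2norm (u2 T - u2 s) <= K * delta) :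
  (exists! Lambda : R, 0 < Lambda /\ Lambda = K + Lambda `^ (s / T)) /\
  forall Lambda : R, 0 < Lambda -> Lambda = K + Lambda `^ (s / T) ->
    forall t : R, 0 <= t <= T ->
      L2norm (u1 t - u2 t) <= 2 * Lambda `^ (t / T) * delta.
Proof.
have /andP[s0 sT] := s_itv.
have a01 : 0 < s / T < 1 by rewrite divr_gt0//= ltr_pdivrMr// mul1r.
split.
  have [x x0 xE] := powR_fixpoint_exists a01 K_gt0.
  exists x; split=> // y [y0 yE].
  exact: powR_fixpoint_unique a01 K_gt0 x0 xE y0 yE.
move=> Lam Lam0 LamE t tT; have /andP[t0 leT] := tT.
have D0 : 0 < 2 * delta by rewrite mulr_gt0.
have interp r (rT : 0 <= r <= T) := L2norm_diff_interpolation phi_basis.1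
  sol1 sol2 T_gt0 rT Lam0.
have n0 : 0 <= L2norm (u1 0 - u2 0) <= 2 * delta.
  rewrite L2norm_ge0/= (_ : u1 0 - u2 0 = (u1 0 - g) - (u2 0 - g)).
    by apply: le_trans (L2normB _ _) _; lra.
  by rewrite opprB addrA subrK.
have nTs : L2norm (u1 T - u2 T) <= L2norm (u1 s - u2 s) + K * (2 * delta).
  (* The regrouping isolates the two increments from [s] to [T], each of norm at most
     [K * delta]. *)
  have -> : u1 T - u2 T = (u1 s - u2 s) + ((u1 T - u1 s) - (u2 T - u2 s)).
    by rewrite [RHS]addrC addrACA subrK -opprD subrK.
  apply: le_trans (L2normD _ _) _; rewrite lerD2l.
  by apply: le_trans (L2normB _ _) _; lra.
have sT' : 0 <= s <= T by rewrite !ltW.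
(* At time [s] the interpolation exponent is [s / T], the one in the equation of [Lam]. *)
have nT := le_of_interpolation a01 K_gt0 Lam0 LamE D0 n0 (L2norm_ge0 _) nTs
  (interp s sT').
have th0 : 0 <= t / T by rewrite divr_ge0// ltW.
have th1 : t / T <= 1 by rewrite ler_pdivrMr// mul1r.
rewrite mulrAC mulrC -(@ler_pXn2r _ 2)// ?nnegrE ?L2norm_ge0//; last first.
  by rewrite mulr_ge0 ?powR_ge0 ?ltW.
apply: (le_trans (interp t tT)); rewrite [leRHS]exprMn ler_wpM2l ?sqr_ge0//.
have {}nT : L2norm (u1 T - u2 T) / Lam <= 2 * delta.
  by rewrite ler_pdivrMr// mulrC.
have /andP[n00 {}n0] := n0.
have h0 : L2norm (u1 0 - u2 0) ^+ 2 <= (2 * delta) ^+ 2.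
  by rewrite ler_pXn2r// nnegrE ltW.
have hT : (L2norm (u1 T - u2 T) / Lam) ^+ 2 <= (2 * delta) ^+ 2.
  by rewrite ler_pXn2r// nnegrE ?divr_ge0 ?L2norm_ge0 ?ltW.
(* Both squares are at most [(2 * delta) ^ 2], hence so is their combination with weights
   [1 - t / T] and [t / T]. *)
nra.
Qed.
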